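(* Let $\Omega\subset\mathbb{H}$ be a spectrally saturated open set, and let $U=\mathfrak{S}(\Omega)$. The space $\mathcal{R}(\Omega)$ is a unital commutative $\mathbb{R}$-algebra, the space $\mathcal{R}(\Omega,\mathbb{H})$ is a right $\mathcal{R}(\Omega)$-module, the map $$\mathcal{O}_s(U,\mathbb{M})\ni F\mapsto F_{\mathbb{H}}\in\mathcal{R}(\Omega,\mathbb{H})$$ is a right module isomorphism (that is, an $\mathbb{R}$-linear bijection with $(Ff)_{\mathbb{H}}=F_{\mathbb{H}}f_{\mathbb{H}}$ for all $F\in\mathcal{O}_s(U,\mathbb{M})$, $f\in\mathcal{O}_s(U)$), and its restriction $$\mathcal{O}_s(U)\ni f\mapsto f_{\mathbb{H}}\in\mathcal{R}(\Omega)$$ is an $\mathbb{R}$-algebra isomorphism. Moreover, for every polynomial $P(\zeta)=\sum_{n=0}^m a_n\zeta^n$, $\zeta\in\mathbb{C}$, with $a_n\in\mathbb{H}$ for all $n=0,1,\ldots,m$, we have $P_{\mathbb{H}}(\mathbf{q})=\sum_{n=0}^m a_n\mathbf{q}^n\in\mathbb{H}$ for all $\mathbf{q}\in\mathbb{H}$.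
   Context: $\mathbb{H}$ is the real algebra of quaternions $\mathbf{x}=x_0+x_1\mathbf{j}+x_2\mathbf{k}+x_3\mathbf{l}$ (imaginary units $\mathbf{j},\mathbf{k},\mathbf{l}$), with Euclidean norm $\|\cdot\|$, real part $\Re\mathbf{x}=x_0$ and imaginary part $\Im\mathbf{x}=x_1\mathbf{j}+x_2\mathbf{k}+x_3\mathbf{l}$. $\mathbb{M}=\mathbb{C}\otimes_{\mathbb{R}}\mathbb{H}=\mathbb{H}+i\mathbb{H}$ is its complexification, a complex algebra in which the complex unit $i$ (independent of $\mathbf{j},\mathbf{k},\mathbf{l}$) commutes with $\mathbb{H}$; it contains $\mathbb{C}$ and $\mathbb{H}$. The conjugation of $\mathbb{M}$ is $\overline{\mathbf{b}+i\mathbf{c}}=\mathbf{b}-i\mathbf{c}$ for $\mathbf{b},\mathbf{c}\in\mathbb{H}$; on $\mathbb{C}$ it is complex conjugation. For $\mathbf{q}\in\mathbb{H}$ put $s_\pm(\mathbf{q})=\Re\mathbf{q}\pm i\|\Im\mathbf{q}\|\in\mathbb{C}$ and $\sigma(\mathbf{q})=\{s_+(\mathbf{q}),s_-(\mathbf{q})\}$ (the spectrum of $\mathbf{q}$ in $\mathbb{M}$). A set $\Omega\subset\mathbb{H}$ is spectrally saturated if whenever $\mathbf{h}\in\mathbb{H}$, $\mathbf{q}\in\Omega$ and $\sigma(\mathbf{h})=\sigma(\mathbf{q})$, then $\mathbf{h}\in\Omega$. Put $\mathfrak{S}(\Omega)=\bigcup_{\mathbf{q}\in\Omega}\sigma(\mathbf{q})\subset\mathbb{C}$.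 For $U\subset\mathbb{C}$ put $U_{\mathbb{H}}=\{\mathbf{q}\in\mathbb{H}:\sigma(\mathbf{q})\subset U\}$. If $\Omega$ is spectrally saturated and open and $U=\mathfrak{S}(\Omega)$, then $U$ is open and conjugate symmetric (i.e. $\zeta\in U\iff\bar\zeta\in U$) and $U_{\mathbb{H}}=\Omega$. For $U$ open and conjugate symmetric, $\mathcal{O}_s(U,\mathbb{M})$ is the set of all analytic functions $F:U\to\mathbb{M}$ that are stem functions, i.e. $F(\bar\zeta)=\overline{F(\zeta)}$ for all $\zeta\in U$; $\mathcal{O}_s(U)$ is the real algebra of all $\mathbb{C}$-valued functions in $\mathcal{O}_s(U,\mathbb{M})$. $\mathcal{O}_s(U,\mathbb{M})$ is a right $\mathcal{O}_s(U)$-module under pointwise multiplication. For $F:U\to\mathbb{M}$, the function $F_{\mathbb{H}}:U_{\mathbb{H}}\to\mathbb{M}$ is defined by $$F_{\mathbb{H}}(\mathbf{q})=F(s_+(\mathbf{q}))\,\iota_+(\mathfrak{s})+F(s_-(\mathbf{q}))\,\iota_-(\mathfrak{s}),\qquad \mathfrak{s}=\frac{\Im\mathbf{q}}{\|\Im\mathbf{q}\|},\quad \iota_\pm(\mathfrak{s})=\tfrac12(1\mp i\mathfrak{s}),$$ when $\Im\mathbf{q}\ne0$, and $F_{\mathbb{H}}(\mathbf{q})=F(\mathbf{q})$ when $\mathbf{q}\in\mathbb{R}$. For analytic $F$ it coincides with the Cauchy transform $\frac{1}{2\pi i}\int_\Gamma F(\zeta)(\zeta-\mathbf{q})^{-1}d\zeta$,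 where $\Gamma$ is the positively oriented boundary of a piecewise smoothly bounded open set $\Delta$ with $\sigma(\mathbf{q})\subset\Delta\subset\bar\Delta\subset U$. When $F$ is a stem function, $F_{\mathbb{H}}$ takes values in $\mathbb{H}$. With $U=\mathfrak{S}(\Omega)$, set $\mathcal{R}(\Omega)=\{f_{\mathbb{H}}:f\in\mathcal{O}_s(U)\}$ and $\mathcal{R}(\Omega,\mathbb{H})=\{F_{\mathbb{H}}:F\in\mathcal{O}_s(U,\mathbb{M})\}$, with pointwise operations of $\mathbb{H}$-valued functions on $\Omega$. In the polynomial statement, $P$ is regarded as an $\mathbb{M}$-valued function on $U=\mathbb{C}$, with $U_{\mathbb{H}}=\mathbb{H}$. *)

(* Defs.v *)
From HB Require Import structures.
From mathcomp Require Import all_boot all_order all_algebra.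
From mathcomp Require Import complex.
From mathcomp Require Import all_classical all_reals all_analysis.
From mathcomp Require Import ring.

Set Implicit Arguments.
Unset Strict Implicit.
Unset Printing Implicit Defensive.

Import Order.TTheory GRing.Theory Num.Theory.
Import numFieldNormedType.Exports.

Local Open Scope ring_scope.
Local Open Scope classical_set_scope.
Local Open Scope complex_scope.

(* Hamilton quaternions x0 + x1 j + x2 k + x3 l with coefficients in K, stored
   as the row (x0, x1, x2, x3).  For R : realType, C is R[i], H is quat R and
   M = C (x)_R H is quat R[i]. *)
Definition quat (K : Type) : Type := 'rV[K]_4.

Section QuatRing.
Variable K : comNzRingType.

HB.instance Definition _ := Choice.on (quat K).
HB.instance Definition _ := GRing.Lmodule.copy (quat K) 'rV[K]_4.

Definition mkquat (a b c d : K) : quat K := \row_(n < 4) [:: a; b; c; d]`_n.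

Definition q0 (x : quat K) : K := x ord0 (@Ordinal 4 0 isT).
Definition q1 (x : quat K) : K := x ord0 (@Ordinal 4 1 isT).
Definition q2 (x : quat K) : K := x ord0 (@Ordinal 4 2 isT).
Definition q3 (x : quat K) : K := x ord0 (@Ordinal 4 3 isT).

(* jj = kk = ll = -1, jk = l = -kj, kl = j = -lk, lj = k = -jl *)
Definition mulquat (x y : quat K) : quat K :=
  mkquat (q0 x * q0 y - q1 x * q1 y - q2 x * q2 y - q3 x * q3 y)
         (q0 x * q1 y + q1 x * q0 y + q2 x * q3 y - q3 x * q2 y)
         (q0 x * q2 y - q1 x * q3 y + q2 x * q0 y + q3 x * q1 y)
         (q0 x * q3 y + q1 x * q2 y - q2 x * q1 y + q3 x * q0 y).

Lemma quatP (x y : quat K) :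
  q0 x = q0 y -> q1 x = q1 y -> q2 x = q2 y -> q3 x = q3 y -> x = y.
Proof.
rewrite /q0 /q1 /q2 /q3 => e0 e1 e2 e3; apply/rowP => -[n nlt].
by case: n nlt => [|[|[|[|//]]]] nlt; rewrite (bool_irrelevance nlt isT).
Qed.

Lemma q0_mk a b c d : q0 (mkquat a b c d) = a. Proof. by rewrite /q0 mxE. Qed.
Lemma q1_mk a b c d : q1 (mkquat a b c d) = b. Proof. by rewrite /q1 mxE. Qed.
Lemma q2_mk a b c d : q2 (mkquat a b c d) = c. Proof. by rewrite /q2 mxE. Qed.
Lemma q3_mk a b c d : q3 (mkquat a b c d) = d. Proof. by rewrite /q3 mxE. Qed.
Lemma q0D x y : q0 (x + y) = q0 x + q0 y. Proof. by rewrite /q0 mxE. Qed.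
Lemma q1D x y : q1 (x + y) = q1 x + q1 y. Proof. by rewrite /q1 mxE. Qed.
Lemma q2D x y : q2 (x + y) = q2 x + q2 y. Proof. by rewrite /q2 mxE. Qed.
Lemma q3D x y : q3 (x + y) = q3 x + q3 y. Proof. by rewrite /q3 mxE. Qed.
Lemma q0Z a x : q0 (a *: x) = a * q0 x. Proof. by rewrite /q0 mxE. Qed.
Lemma q1Z a x : q1 (a *: x) = a * q1 x. Proof. by rewrite /q1 mxE. Qed.
Lemma q2Z a x : q2 (a *: x) = a * q2 x. Proof. by rewrite /q2 mxE. Qed.
Lemma q3Z a x : q3 (a *: x) = a * q3 x. Proof. by rewrite /q3 mxE. Qed.
Definition quatE := (q0_mk, q1_mk, q2_mk, q3_mk, q0D, q1D, q2D, q3D,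
                     q0Z, q1Z, q2Z, q3Z).

Fact mulquatA : associative mulquat.
Proof. by move=> x y z; apply: quatP; rewrite /mulquat !quatE; ring. Qed.
Fact mul1quat : left_id (mkquat 1 0 0 0) mulquat.
Proof. by move=> x; apply: quatP; rewrite /mulquat !quatE; ring. Qed.
Fact mulquat1 : right_id (mkquat 1 0 0 0) mulquat.
Proof. by move=> x; apply: quatP; rewrite /mulquat !quatE; ring. Qed.
Fact mulquatDl : left_distributive mulquat +%R.
Proof. by move=> x y z; apply: quatP; rewrite /mulquat !quatE; ring. Qed.
Fact mulquatDr : right_distributive mulquat +%R.
Proof. by move=> x y z; apply: quatP; rewrite /mulquat !quatE; ring. Qed.
Fact quat1_neq0 : mkquat 1 0 0 0 != 0.
Proof.
by apply/eqP => /(congr1 q0); rewrite q0_mk /q0 mxE; apply/eqP/oner_neq0.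
Qed.

HB.instance Definition _ := GRing.Zmodule_isNzRing.Build (quat K)
  mulquatA mul1quat mulquat1 mulquatDl mulquatDr quat1_neq0.

Fact scalequatAl (a : K) (x y : quat K) : a *: (x * y) = (a *: x) * y.
Proof.
by apply: quatP; rewrite /GRing.mul /= /mulquat !quatE; ring.
Qed.
HB.instance Definition _ :=
  GRing.Lmodule_isLalgebra.Build K (quat K) scalequatAl.

Fact scalequatAr (a : K) (x y : quat K) : a *: (x * y) = x * (a *: y).
Proof.
by apply: quatP; rewrite /GRing.mul /= /mulquat !quatE; ring.
Qed.
HB.instance Definition _ :=
  GRing.Lalgebra_isAlgebra.Build K (quat K) scalequatAr.

Definition imq (x : quat K) : quat K := mkquat 0 (q1 x) (q2 x) (q3 x).

End QuatRing.

(* The library's topology on K^4.  The norm `|x| of this instance is the sup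
   norm of the coordinates; it only serves to provide the topology, and the
   Euclidean norm of H is qnorm below. *)
HB.instance Definition _ (K : numFieldType) :=
  NormedModule.copy (quat K) 'rV[K]_4.

Section Complexification.
Variable R : realType.

Definition qnorm (x : quat R) : R :=
  Num.sqrt (q0 x ^+ 2 + q1 x ^+ 2 + q2 x ^+ 2 + q3 x ^+ 2).

(* The embedding of H in M; C is embedded in M as c |-> c%:A, and the complex
   unit of M is 'i%:A, so that multiplication by it is 'i *: _. *)
Definition toM (x : quat R) : quat R[i] := map_mx (real_complex R) x.

Lemma toMD x y : toM (x + y) = toM x + toM y.
Proof. by apply/rowP => n; rewrite !mxE rmorphD. Qed.

Lemma q0_toM x : q0 (toM x) = (q0 x)%:C. Proof. by rewrite /q0 mxE. Qed.
Lemma q1_toM x : q1 (toM x) = (q1 x)%:C. Proof. by rewrite /q1 mxE. Qed.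
Lemma q2_toM x : q2 (toM x) = (q2 x)%:C. Proof. by rewrite /q2 mxE. Qed.
Lemma q3_toM x : q3 (toM x) = (q3 x)%:C. Proof. by rewrite /q3 mxE. Qed.
Definition toME := (q0_toM, q1_toM, q2_toM, q3_toM).

Lemma toMM x y : toM (x * y) = toM x * toM y.
Proof.
by apply: quatP; rewrite toME /GRing.mul /= /mulquat !quatE !toME;
   rewrite !(rmorphB, rmorphD, rmorphM).
Qed.

(* The two components of an element b + i c of M = H + iH. *)
Definition reM (x : quat R[i]) : quat R := map_mx (@complex.Re R) x.
Definition imM (x : quat R[i]) : quat R := map_mx (@complex.Im R) x.

Lemma M_decomp (x : quat R[i]) : x = toM (reM x) + 'i *: toM (imM x).
Proof.
by apply/rowP => n; rewrite !mxE; exact: complexE.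
Qed.

Definition conjM (x : quat R[i]) : quat R[i] :=
  toM (reM x) - 'i *: toM (imM x).

Definition s_plus (q : quat R) : R[i] := q0 q +i* qnorm (imq q).
Definition s_minus (q : quat R) : R[i] := q0 q -i* qnorm (imq q).
Definition spectrum (q : quat R) : set R[i] := [set s_plus q; s_minus q].

Definition spectrally_saturated (Omega : set (quat R)) :=
  forall h q : quat R, Omega q -> spectrum h = spectrum q -> Omega h.

Definition spectral_image (Omega : set (quat R)) : set R[i] :=
  \bigcup_(q in Omega) spectrum q.

Definition iota_plus (s : quat R) : quat R[i] := 2^-1 *: (1 - 'i *: toM s).
Definition iota_minus (s : quat R) : quat R[i] := 2^-1 *: (1 + 'i *: toM s).

(* q |-> F_H(q), for F defined at least on the spectrum of q *)
Definition qtransform (F : R[i] -> quat R[i]) (q : quat R) : quat R[i] :=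
  if imq q == 0 then F (q0 q)%:C
  else let s := (qnorm (imq q))^-1 *: imq q in
       F (s_plus q) * iota_plus s + F (s_minus q) * iota_minus s.

(* Analytic means complex differentiable at each point of the open set U; the
   function on the subtype U is extended by 0, which does not affect the
   derivatives at points of U. *)
Definition analytic (U : set R[i]) (F : U -> quat R[i]) :=
  forall z : R[i]^o, U z -> derivable ('valL_ 0 F : R[i]^o -> quat R[i]) z 1.

Definition stem (U : set R[i]) (F : U -> quat R[i]) :=
  forall z w : U, \val w = (\val z)^* -> F w = conjM (F z).

Definition OsM (U : set R[i]) : set (U -> quat R[i]) :=
  [set F | analytic F /\ stem F].

(* The C-valued functions among them *)
Definition Os (U : set R[i]) : set (U -> quat R[i]) :=
  [set F | OsM F /\ forall z, exists c : R[i], F z = c%:A].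

Definition FH (Omega : set (quat R)) (F : spectral_image Omega -> quat R[i]) :
    Omega -> quat R[i] :=
  fun q => qtransform ('valL_ 0 F) (\val q).

(* As H is a subalgebra of M, the spaces R(Omega) and R(Omega, H) are taken
   inside the ring of M-valued functions on Omega. *)
Definition ROmega (Omega : set (quat R)) : set (Omega -> quat R[i]) :=
  @FH Omega @` @Os (spectral_image Omega).

Definition ROmegaH (Omega : set (quat R)) : set (Omega -> quat R[i]) :=
  @FH Omega @` @OsM (spectral_image Omega).

(* The identities of a real algebra, or of a right module, hold in the ring
   T -> M with pointwise operations; what is at stake is that the subset
   contains the required elements, and commutativity. *)
Definition unital_comm_real_algebra (T : Type) (A : set (T -> quat R[i])) :=
  [/\ A 1,
      forall f g, A f -> A g -> A (f + g),
      forall (a : R) f, A f -> A (a%:C *: f),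
      forall f g, A f -> A g -> A (f * g)
    & forall f g, A f -> A g -> f * g = g * f].

Definition right_module (T : Type) (A V : set (T -> quat R[i])) :=
  [/\ V 0,
      forall g h, V g -> V h -> V (g + h),
      forall g, V g -> V (- g)
    & forall g f, V g -> A f -> V (g * f)].

Definition real_linear_on (T T' : Type) (V : set (T -> quat R[i]))
    (phi : (T -> quat R[i]) -> (T' -> quat R[i])) :=
  (forall F G, V F -> V G -> phi (F + G) = phi F + phi G) /\
  (forall (a : R) F, V F -> phi (a%:C *: F) = a%:C *: phi F).

End Complexification.

Arguments OsM {R} U _.
Arguments Os {R} U _.
Arguments ROmega {R} Omega _.
Arguments ROmegaH {R} Omega _.

(* Main.v *)
Require Import Defs.
From HB Require Import structures.
From mathcomp Require Import all_boot all_order all_algebra.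
From mathcomp Require Import complex.
From mathcomp Require Import all_classical all_reals all_analysis.
Import Order.TTheory GRing.Theory Num.Theory.
Import numFieldNormedType.Exports.
Local Open Scope ring_scope.
Local Open Scope classical_set_scope.
Local Open Scope complex_scope.
From mathcomp Require Import ring.

Set Implicit Arguments.
Unset Strict Implicit.
Unset Printing Implicit Defensive.

(** Write q = x + n s with x the real part of q, n the norm of its imaginary
    part and s an imaginary unit, s^2 = -1.  Then (i s)^2 = 1 in M, so that
    iota_plus s and iota_minus s are the two complementary orthogonal
    idempotents of the subalgebra C[s] of M, and F_H(q) has the components
    F(s_plus q) and F(s_minus q) along them.  If q is real, then
    s_plus q = s_minus q and the formula gives F(q) for every choice of s,
    because the idempotents add up to 1; choosing one such s ([axis])
    therefore gives a single formula for all q ([qtransformE]), and no later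
    argument needs to treat real quaternions apart, except [qtransform_conj].

    The statements follow from this spectral decomposition.
    - Scalar-valued functions are central, so (F f)_H = F_H f_H is the
      orthogonality of the idempotents ([qtransformM]).  The identity function
      has transform q, hence zeta^n has transform q^n, and left
      linearity gives the formula for polynomials ([qtransform_poly]).
    - The conjugation of M exchanges the two idempotents, and a stem function
      takes conjugate values at s_plus q and s_minus q; the two terms of F_H(q)
      are then conjugate to each other, so their sum is in H
      ([qtransform_stem]).
    - The quaternionic conjugate q' of q has the same spectrum, with the
      idempotents exchanged.  Hence F(s_plus q) and F(s_minus q) can be
      recovered from F_H(q) and F_H(q') ([qtransform_inv_plus],
      [qtransform_inv_minus]); as q' remains in Omega, F |-> F_H is injective.

    What remains is the stability of the analytic stem functions under the
    module operations.  Differentiability of products is a product rule for a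
    scalar function times a vector-valued one ([derivableZ_fun]).  Openness of
    U matters for the unit: the function 1 on U, extended by 0, is
    differentiable at the points of U because it is constant around
    them.  By saturation U is the preimage of Omega under x + i y |-> x + y j,
    which is continuous ([open_spectral_image]). *)

(** * Spectral decomposition of a quaternion *)

Section SpectralDecomposition.
Variable R : realType.
Implicit Types (q s : quat R) (F G : R[i] -> quat R[i]).

Lemma toMZ (a : R) q : toM (a *: q) = a%:C *: toM q.
Proof. by apply/rowP => n; rewrite !mxE rmorphM. Qed.

Lemma toM1 : toM (1 : quat R) = 1.
Proof. by apply: quatP; rewrite !toME !quatE ?rmorph1 ?rmorph0. Qed.

Lemma toM0 : toM (0 : quat R) = 0.
Proof. by apply/rowP => n; rewrite !mxE rmorph0. Qed.

Lemma toMN q : toM (- q) = - toM q.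
Proof. by apply/rowP => n; rewrite !mxE rmorphN. Qed.

(** For real q any imaginary unit serves: the value j makes [axis_sqr] and
    [qtransformE] hold without an exception. *)
Definition axis q : quat R :=
  if imq q == 0 then mkquat 0 1 0 0 else (qnorm (imq q))^-1 *: imq q.

Lemma qnorm_imq_sqr q :
  qnorm (imq q) ^+ 2 = q1 q ^+ 2 + q2 q ^+ 2 + q3 q ^+ 2.
Proof.
rewrite /qnorm sqr_sqrtr; last by rewrite !addr_ge0 ?sqr_ge0.
by rewrite !quatE expr0n add0r.
Qed.

Lemma imq_sqr q : imq q * imq q = - (qnorm (imq q) ^+ 2)%:A.
Proof.
by rewrite qnorm_imq_sqr -scaleNr; apply: quatP;
   rewrite /GRing.mul /= /mulquat !quatE; ring.
Qed.

Lemma qnorm_imq_eq0 q : (qnorm (imq q) == 0) = (imq q == 0).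
Proof.
apply/eqP/eqP => [n0|->]; last first.
  by rewrite /qnorm /q0 /q1 /q2 /q3 !mxE expr0n !addr0 sqrtr0.
have := qnorm_imq_sqr q; rewrite n0 expr0n /= => /eqP.
rewrite eq_sym !paddr_eq0 ?addr_ge0 ?sqr_ge0// !sqrf_eq0 => /andP[/andP[]].
move=> /eqP e1 /eqP e2 /eqP e3.
by rewrite /imq e1 e2 e3; apply: quatP; rewrite !quatE /q0 /q1 /q2 /q3 mxE.
Qed.

Lemma axis_sqr q : axis q * axis q = -1.
Proof.
rewrite /axis; case: ifPn => [_|nz].
  by rewrite -scaleN1r; apply: quatP; rewrite /GRing.mul /= /mulquat !quatE; ring.
rewrite -scalerAl -scalerAr scalerA imq_sqr -scaleNr scalerA.
rewrite mulrN -expr2 -exprMn mulVf ?expr1n ?scaleN1r//.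
by rewrite qnorm_imq_eq0.
Qed.

Lemma quat_polar q : q = (q0 q)%:A + qnorm (imq q) *: axis q.
Proof.
have -> : qnorm (imq q) *: axis q = imq q.
  rewrite /axis; case: ifPn => [/eqP z|nz].
    by move/eqP: (z); rewrite -qnorm_imq_eq0 z => /eqP->; rewrite scale0r.
  by rewrite scalerA mulfV ?scale1r// qnorm_imq_eq0.
by apply: quatP; rewrite !quatE; ring.
Qed.

Lemma scale_half_double (V : lmodType R[i]) (x : V) : 2^-1 *: (x *+ 2) = x.
Proof. by rewrite -[x *+ 2]scaler_nat scalerA mulVf ?scale1r// pnatr_eq0. Qed.

Lemma iotaD s : iota_plus s + iota_minus s = 1.
Proof.
by rewrite /iota_plus /iota_minus -scalerDr addrACA addNr addr0 scale_half_double.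
Qed.

Lemma iota_minusE s : iota_minus s = 1 - iota_plus s.
Proof. by rewrite -(iotaD s) addrAC subrr add0r. Qed.

Lemma iotaB s : iota_minus s - iota_plus s = 'i *: toM s.
Proof.
rewrite /iota_plus /iota_minus -scalerBr opprB addrC addrA addrNK.
by rewrite -mulr2n scale_half_double.
Qed.

Lemma i_imag_unit_sqr s : s * s = -1 -> ('i *: toM s) * ('i *: toM s) = 1.
Proof.
move=> s2; rewrite -scalerAl -scalerAr scalerA -toMM s2 toMN toM1 -expr2 sqrCi.
by rewrite scaleN1r opprK.
Qed.

Section Idempotents.
Variable s : quat R.
Hypothesis s2 : s * s = -1.

Lemma iota_plusM : iota_plus s * iota_plus s = iota_plus s.
Proof.
rewrite /iota_plus; set t := 'i *: toM s.
rewrite -scalerAl -scalerAr; congr (_ *: _).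
rewrite mulrBl mul1r mulrBr mulr1 (i_imag_unit_sqr s2).
by rewrite opprB -[_ + (1 - t)]mulr2n scale_half_double.
Qed.

Lemma iota_plus_minus : iota_plus s * iota_minus s = 0.
Proof. by rewrite iota_minusE mulrBr mulr1 iota_plusM subrr. Qed.

Lemma iota_minus_plus : iota_minus s * iota_plus s = 0.
Proof. by rewrite iota_minusE mulrBl mul1r iota_plusM subrr. Qed.

Lemma iota_minusM : iota_minus s * iota_minus s = iota_minus s.
Proof. by rewrite {1}iota_minusE mulrBl mul1r iota_plus_minus subr0. Qed.

End Idempotents.

(** On the real axis both values are F(q), and the idempotents add up to 1. *)
Lemma qtransformE F q :
  qtransform F q = F (s_plus q) * iota_plus (axis q)
                 + F (s_minus q) * iota_minus (axis q).
Proof.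
rewrite /qtransform; case: ifPn => [z|nz]; last first.
  by rewrite /axis (negPf nz).
move: z; rewrite /s_plus /s_minus -qnorm_imq_eq0 => /eqP ->.
by rewrite oppr0 -mulrDr iotaD mulr1.
Qed.

Lemma qtransformD F G q :
  qtransform (fun z => F z + G z) q = qtransform F q + qtransform G q.
Proof.
rewrite !qtransformE; move: (iota_plus _) (iota_minus _) => e e'.
by rewrite !mulrDl addrACA.
Qed.

Lemma qtransform_mull (a : quat R[i]) F q :
  qtransform (fun z => a * F z) q = a * qtransform F q.
Proof.
rewrite !qtransformE; move: (iota_plus _) (iota_minus _) => e e'.
by rewrite mulrDr !mulrA.
Qed.

Lemma qtransformZ (c : R[i]) F q :
  qtransform (fun z => c *: F z) q = c *: qtransform F q.
Proof.
rewrite !qtransformE; move: (iota_plus _) (iota_minus _) => e e'.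
by rewrite scalerDr !scalerAl.
Qed.

Lemma qtransform0 q : qtransform (fun=> 0) q = 0.
Proof.
rewrite qtransformE; move: (iota_plus _) (iota_minus _) => e e'.
by rewrite !mul0r addr0.
Qed.

Lemma qtransform1 q : qtransform (fun=> 1) q = 1.
Proof. by rewrite qtransformE !mul1r iotaD. Qed.

(** The factor (f z)%:A is central, so that both products are computed along the
    idempotents, where the mixed terms vanish. *)
Lemma qtransformM F (f : R[i] -> R[i]) q :
  qtransform (fun z => F z * (f z)%:A) q =
  qtransform F q * qtransform (fun z => (f z)%:A) q.
Proof.
rewrite !qtransformE; have s2 := axis_sqr q.
move: (iota_plusM s2) (iota_minusM s2) (iota_plus_minus s2) (iota_minus_plus s2).
move: (iota_plus _) (iota_minus _) => e e' ee e'e' ee' e'e.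
rewrite !mulr_algr !mulr_algl mulrDr !mulrDl -!scalerAl -!scalerAr -!mulrA.
by rewrite ee e'e' ee' e'e !mulr0 !scaler0 addr0 add0r.
Qed.

(** This is q = x + n s decomposed along the idempotents: s acts on iota_plus s
    as i, and on iota_minus s as -i. *)
Lemma qtransform_id q : qtransform (fun z => z%:A) q = toM q.
Proof.
rewrite [in RHS](quat_polar q) toMD !toMZ toM1 qtransformE !mulr_algl.
rewrite -(iotaD (axis q)).
(* Spectral form of the axis: the eigenvalues of s are i and -i. *)
have -> : toM (axis q) = 'i *: (iota_plus (axis q) - iota_minus (axis q)).
  by rewrite -opprB iotaB scalerN scalerA -expr2 sqrCi scaleN1r opprK.
have -> : s_plus q = (q0 q)%:C + 'i * (qnorm (imq q))%:C.
  by rewrite [LHS]complexE.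
have -> : s_minus q = (q0 q)%:C - 'i * (qnorm (imq q))%:C.
  by rewrite [LHS]complexE /= rmorphN mulrN.
move: (iota_plus _) (iota_minus _) ((q0 q)%:C) ((qnorm _)%:C) => e e' x n.
by rewrite [n *: _]scalerA [n * _]mulrC scalerBr scalerDr scalerDl scalerBl addrACA.
Qed.

(** Scalar functions are transformed multiplicatively, so powers of the identity
    function give powers of q. *)
Lemma qtransformX q n : qtransform (fun z => (z ^+ n)%:A) q = toM (q ^+ n).
Proof.
elim: n => [|n IH].
  rewrite expr0 toM1 -[RHS](qtransform1 q); congr (qtransform _ q).
  by apply/funext => z; rewrite expr0 scale1r.
rewrite exprSr toMM -IH -qtransform_id -qtransformM; congr (qtransform _ q).
by apply/funext => z; rewrite exprSr mulr_algl scalerA mulrC.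
Qed.

Lemma qtransform_poly (m : nat) (a : nat -> quat R) q :
  qtransform (fun z => \sum_(n < m) toM (a n) * (z ^+ n)%:A) q
  = toM (\sum_(n < m) a n * q ^+ n).
Proof.
elim: m => [|m IH].
  rewrite [in RHS]big_ord0 toM0 -[RHS](qtransform0 q); congr (qtransform _ q).
  by apply/funext => z; rewrite big_ord0.
rewrite big_ord_recr /= toMD toMM -IH -qtransformX -qtransform_mull -qtransformD.
by congr (qtransform _ q); apply/funext => z; rewrite big_ord_recr.
Qed.

End SpectralDecomposition.

(** * Conjugations of M and of H *)

Section Conjugations.
Variable R : realType.
Implicit Types (q s : quat R) (x y : quat R[i]) (F G : R[i] -> quat R[i]).

Lemma conjc_i : conjc ('i : R[i]) = - 'i.
Proof. by apply/eqP; rewrite eq_complex /= ?oppr0 !eqxx. Qed.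

Lemma conjc_add (a b : R[i]) : conjc (a + b) = conjc a + conjc b.
Proof. exact: rmorphD. Qed.

Lemma conjc_mul (a b : R[i]) : conjc (a * b) = conjc a * conjc b.
Proof. exact: rmorphM. Qed.

Lemma conjME x : conjM x = map_mx (@conjc R) x.
Proof.
apply/rowP => n; rewrite !mxE [in RHS](complexE (x ord0 n)) conjc_add conjc_mul.
by rewrite conjc_i !conjc_real mulNr.
Qed.

Lemma conjMM x y : conjM (x * y) = conjM x * conjM y.
Proof.
rewrite !conjME; apply: quatP;
  rewrite /GRing.mul /= /mulquat !quatE /q0 /q1 /q2 /q3 !mxE;
  by rewrite !(rmorphB, rmorphD, rmorphM).
Qed.

Lemma conjMD x y : conjM (x + y) = conjM x + conjM y.
Proof. by rewrite !conjME; apply/rowP => n; rewrite !mxE conjc_add. Qed.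

Lemma conjMZ (c : R[i]) x : conjM (c *: x) = conjc c *: conjM x.
Proof. by rewrite !conjME; apply/rowP => n; rewrite !mxE conjc_mul. Qed.

Lemma conjMK x : conjM (conjM x) = x.
Proof. by rewrite !conjME; apply/rowP => n; rewrite !mxE conjcK. Qed.

Lemma conjM_toM q : conjM (toM q) = toM q.
Proof. by rewrite !conjME; apply/rowP => n; rewrite !mxE conjc_real. Qed.

Lemma conjM_fixed x : conjM x = x -> x = toM (reM x).
Proof.
move=> xx; have dx := M_decomp x; move: xx; rewrite /conjM.
move: (toM (reM x)) ('i *: _) dx => a b dx xx.
(* x is the average of x and its conjugate, that is, its part in H. *)
rewrite -[LHS]scale_half_double -[RHS]scale_half_double; congr (_ *: _).
by rewrite [LHS]mulr2n -{1}xx dx addrACA addNr addr0.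
Qed.

Lemma conjM_iota_plus s : conjM (iota_plus s) = iota_minus s.
Proof.
rewrite conjMZ conjMD -[- _]scaleN1r scalerA !conjMZ -toM1 !conjM_toM.
rewrite conjc_mul conjc_i (rmorphN1 (@conjc R)) mulrN mulN1r opprK.
by rewrite (fmorphV (@conjc R)) (rmorph_nat (@conjc R)) toM1.
Qed.

Lemma conjM_iota_minus s : conjM (iota_minus s) = iota_plus s.
Proof. by rewrite -conjM_iota_plus conjMK. Qed.

(** The conjugation exchanges the two terms of the spectral formula for
    F_H(q), so F_H(q) is fixed by it. *)
Lemma qtransform_stem F q : F (s_minus q) = conjM (F (s_plus q)) ->
  exists h, qtransform F q = toM h.
Proof.
move=> Fq; exists (reM (qtransform F q)); apply: conjM_fixed.
rewrite qtransformE; have := conjM_iota_plus (axis q).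
have := conjM_iota_minus (axis q).
move: (iota_plus _) (iota_minus _) => e e' ce' ce.
by rewrite conjMD !conjMM ce ce' Fq conjMK addrC.
Qed.

Definition quat_conj q : quat R := (q0 q)%:A - imq q.

Lemma q0_quat_conj q : q0 (quat_conj q) = q0 q.
Proof. by rewrite /quat_conj -scaleN1r !quatE mulr0 addr0 mulr1. Qed.

Lemma imq_quat_conj q : imq (quat_conj q) = - imq q.
Proof. by rewrite /quat_conj -scaleN1r; apply: quatP; rewrite !quatE; ring. Qed.

Lemma qnormN q : qnorm (- q) = qnorm q.
Proof. by rewrite /qnorm /q0 /q1 /q2 /q3 !mxE !sqrrN. Qed.

Lemma s_plus_quat_conj q : s_plus (quat_conj q) = s_plus q.
Proof. by rewrite /s_plus q0_quat_conj imq_quat_conj qnormN. Qed.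

Lemma s_minus_quat_conj q : s_minus (quat_conj q) = s_minus q.
Proof. by rewrite /s_minus q0_quat_conj imq_quat_conj qnormN. Qed.

Lemma iota_plusN s : iota_plus (- s) = iota_minus s.
Proof. by rewrite /iota_plus toMN scalerN opprK. Qed.

Lemma iota_minusN s : iota_minus (- s) = iota_plus s.
Proof. by rewrite -iota_plusN opprK. Qed.

(** Passing from q to its quaternionic conjugate reverses the axis and keeps the
    spectrum.  If q is real, the axis is not reversed but both values
    of F agree. *)
Lemma qtransform_conj F q :
  qtransform F (quat_conj q) = F (s_plus q) * iota_minus (axis q)
                             + F (s_minus q) * iota_plus (axis q).
Proof.
have [z|nz] := eqVneq (imq q) 0.
  rewrite qtransformE s_plus_quat_conj s_minus_quat_conj.
  have -> : s_minus q = s_plus q.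
    move/eqP: z; rewrite /s_minus /s_plus -qnorm_imq_eq0 => /eqP ->.
    by rewrite oppr0.
  have := iotaD (axis q); have := iotaD (axis (quat_conj q)).
  move: (iota_plus _) (iota_minus _) => d d' dd'.
  move: (iota_plus _) (iota_minus _) => e e' ee'.
  by rewrite -!mulrDr dd' addrC ee'.
have aq : axis (quat_conj q) = - axis q.
  by rewrite /axis imq_quat_conj oppr_eq0 (negPf nz) qnormN scalerN.
by rewrite qtransformE s_plus_quat_conj s_minus_quat_conj aq iota_plusN iota_minusN.
Qed.

(** Multiplying the transforms at q and at its conjugate by suitable idempotents
    isolates a single value of F, which is the reason why F_H determines F. *)
Lemma qtransform_inv_plus F q : F (s_plus q) =
  qtransform F q * iota_plus (axis q)
  + qtransform F (quat_conj q) * iota_minus (axis q).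
Proof.
rewrite qtransform_conj qtransformE; have s2 := axis_sqr q.
move: (iota_plusM s2) (iota_minusM s2) (iota_plus_minus s2) (iota_minus_plus s2).
move: (iotaD (axis q)).
move: (iota_plus _) (iota_minus _) => e e' De ee e'e' ee' e'e.
rewrite !mulrDl -!mulrA ee e'e' ee' e'e.
by rewrite !mulr0 !addr0 -mulrDr De mulr1.
Qed.

Lemma qtransform_inv_minus F q : F (s_minus q) =
  qtransform F q * iota_minus (axis q)
  + qtransform F (quat_conj q) * iota_plus (axis q).
Proof.
rewrite qtransform_conj qtransformE; have s2 := axis_sqr q.
move: (iota_plusM s2) (iota_minusM s2) (iota_plus_minus s2) (iota_minus_plus s2).
move: (iotaD (axis q)).
move: (iota_plus _) (iota_minus _) => e e' De ee e'e' ee' e'e.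
rewrite !mulrDl -!mulrA ee e'e' ee' e'e.
by rewrite !mulr0 !add0r -mulrDr [e' + e]addrC De mulr1.
Qed.

Lemma spectrum_quat_conj q : spectrum (quat_conj q) = spectrum q.
Proof. by rewrite /spectrum s_plus_quat_conj s_minus_quat_conj. Qed.

End Conjugations.

(** * Openness of the spectral image *)

Section SpectralImage.
Variable R : realType.
Implicit Types (q : quat R) (z : R[i]).

Definition slice (z : R[i]) : quat R := mkquat (complex.Re z) (complex.Im z) 0 0.

Lemma qnorm_imq_slice z : qnorm (imq (slice z)) = `|complex.Im z|.
Proof. by rewrite /qnorm !quatE !expr0n add0r !addr0 sqrtr_sqr. Qed.

Lemma spectrum_slice q z : spectrum q z -> spectrum (slice z) = spectrum q.
Proof.
have n0 : 0 <= qnorm (imq q) by rewrite sqrtr_ge0.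
rewrite /spectrum /s_plus /s_minus qnorm_imq_slice => -[] -> /=;
  rewrite ?normrN; by rewrite /slice !quatE ger0_norm.
Qed.

Lemma mem_spectrum_slice z : spectrum (slice z) z.
Proof.
case: z => x y; rewrite /spectrum /s_plus /s_minus qnorm_imq_slice quatE /=.
have [y0|y0] := leP 0 y; first by left; rewrite ger0_norm.
by right; rewrite ltr0_norm// opprK.
Qed.

(** All quaternions with the same spectrum are in Omega together, and the
    slice R + R j contains one of each spectrum. *)
Lemma spectral_imageE (Omega : set (quat R)) : spectrally_saturated Omega ->
  spectral_image Omega = slice @^-1` Omega.
Proof.
move=> sat; apply/seteqP; split=> z.
  by move=> [q Oq qz]; apply: (sat _ _ Oq); exact: spectrum_slice.
by move=> Oz; exists (slice z) => //; exact: mem_spectrum_slice.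
Qed.

Lemma normc_ge_Im (z : R[i]) : `|complex.Im z|%:C <= `|z|.
Proof.
rewrite -[leRHS]mul1r -(normCi R[i]) -normrM; apply: le_trans (normc_ge_Re _).
by rewrite lecR -normrN; case: z => a b /=; rewrite mul0r mul1r sub0r.
Qed.

(** The Euclidean topology of the complex numbers and the sup norm on H are
    compared by |Re z|, |Im z| <= |z|; they live over different scalar fields,
    so the comparison is made on balls. *)
Lemma continuous_slice : continuous (slice : R[i]^o -> quat R).
Proof.
move=> z A /nbhs_ballP[e /= e0 eA].
have e0C : 0 < e%:C :> R[i] by rewrite ltcR.
apply/nbhs_ballP; exists e%:C => // w; rewrite -ball_normE /= => zw.
apply: eA; split => // i j.
have Re_lt : `|complex.Re z - complex.Re w| < e.
  by rewrite -ltcR; apply: le_lt_trans zw; rewrite -raddfB; exact: normc_ge_Re.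
have Im_lt : `|complex.Im z - complex.Im w| < e.
  by rewrite -ltcR; apply: le_lt_trans zw; rewrite -raddfB; exact: normc_ge_Im.
rewrite -ball_normE /ball_ /= !mxE.
by case: j => -[|[|[|[|//]]]] ? //=; rewrite subrr normr0.
Qed.

Lemma open_spectral_image (Omega : set (quat R)) :
  spectrally_saturated Omega -> open Omega ->
  open (spectral_image Omega : set R[i]^o).
Proof.
move=> sat oO; rewrite spectral_imageE//; apply: open_comp oO.
by move=> z _; exact: continuous_slice.
Qed.

End SpectralImage.

(** * Product rule *)

Section ProductRule.
Variable K : numFieldType.

Lemma scale_diff_quotient (V : lmodType K) (h a b : K) (x y : V) :
  a *: (h *: (x - y)) + (h * (a - b)) *: y = h *: (a *: x - b *: y).
Proof.
rewrite scalerA mulrC -scalerA -scalerA -scalerDr; congr (_ *: _).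
by rewrite scalerBr scalerBl addrA addrNK.
Qed.

(** The difference quotient is split as k(x + h v) (F(x + h v) - F(x)) / h
    + ((k(x + h v) - k(x)) / h) F(x), and k is continuous along the line. *)
Lemma derivableZ_fun (V W : normedModType K) (k : V -> K) (F : V -> W)
    (x v : V) :
  derivable k x v -> derivable F x v -> derivable (fun w => k w *: F w) x v.
Proof.
move=> dk dF; apply/cvg_ex; exists (k x *: 'D_v F x + 'D_v k x *: F x).
have kc : k (h *: v + x) @[h --> 0^'] --> k x.
  have : {for 0, continuous (fun h : K => k (h *: v + x))}.
    exact/differentiable_continuous/derivable1_diffP/(derivable1P _ _ _).1.
  by move=> /continuous_withinNx; rewrite scale0r add0r.
apply: cvg_trans (cvgD (cvgZ kc dF) (cvgZ dk (cvg_cst (F x)))).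
apply: near_eq_cvg; near=> h.
exact: scale_diff_quotient.
Unshelve. all: by end_near. Qed.

End ProductRule.

(** * Analytic stem functions *)

Section StemFunctions.
Variable R : realType.
Implicit Types U : set R[i].

Lemma valL_in (T : Type) U (F : U -> T) d (z : R[i]) (Uz : z \in U) :
  'valL_d F z = F (exist _ z Uz).
Proof. exact: (congr1 (fun f => f (exist _ z Uz)) (valLK d F)). Qed.

Lemma valL_out (T : Type) U (F : U -> T) d (z : R[i]) : z \notin U -> 'valL_d F z = d.
Proof. by move=> nU; rewrite /valL_ /= oinv_set_val insubN. Qed.

(** The operations of the module preserve 0, so they can be moved through the
    extension by 0; the constant 1 cannot, and [Os1] uses openness instead. *)
Lemma valL_map2 U (op : quat R[i] -> quat R[i] -> quat R[i]) (F G : U -> quat R[i]) :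
  op 0 0 = 0 ->
  'valL_0 (fun u => op (F u) (G u)) = (fun z => op ('valL_0 F z) ('valL_0 G z)).
Proof.
move=> op0; apply/funext => z; have [Uz|Uz] := boolP (z \in U).
  by rewrite !valL_in.
by rewrite !valL_out.
Qed.

(** A scalar is the real part of itself, so the scalar is read off as the
    coordinate q0; this form is what the product rule and [qtransformM] need. *)
Lemma valL_Cscalar U (f : U -> quat R[i]) :
    (forall u, exists c : R[i], f u = c%:A) ->
  'valL_0 f = (fun z => (q0 ('valL_0 f z))%:A).
Proof.
move=> fC; apply/funext => z; have [Uz|Uz] := boolP (z \in U); last first.
  by rewrite valL_out// /q0 mxE scale0r.
rewrite valL_in; have [c ->] := fC (exist _ z Uz).
by rewrite q0Z q0_mk mulr1.
Qed.

Lemma valL_scalarM U (F f : U -> quat R[i]) :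
    (forall u, exists c : R[i], f u = c%:A) ->
  'valL_0 (F * f) = (fun z => 'valL_0 F z * (q0 ('valL_0 f z))%:A).
Proof.
move=> fC; rewrite (valL_map2 (op := *%R)) ?mulr0//.
by apply/funext => z; rewrite [in LHS](valL_Cscalar fC).
Qed.

Lemma valL_add U (F G : U -> quat R[i]) :
  'valL_0 (F + G) = (fun z => 'valL_0 F z + 'valL_0 G z).
Proof. by apply: (valL_map2 (op := +%R)); rewrite addr0. Qed.

Lemma valL_scale U (c : R[i]) (F : U -> quat R[i]) :
  'valL_0 (c *: F) = (fun z => c *: 'valL_0 F z).
Proof. by apply: (valL_map2 (op := fun x _ => c *: x) F F); rewrite scaler0. Qed.

Lemma derivable_q0 (F : R[i]^o -> quat R[i]) (z : R[i]^o) :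
  derivable F z 1 -> derivable (fun w => q0 (F w) : R[i]^o) z 1.
Proof.
move=> /derivable1_diffP dF; apply/derivable1_diffP.
exact: (differentiable_comp dF (differentiable_coord _ _ _)).
Qed.

Lemma OsMD U (F G : U -> quat R[i]) : OsM U F -> OsM U G -> OsM U (F + G).
Proof.
move=> [aF sF] [aG sG]; split.
  by move=> z Uz; rewrite valL_add; apply: derivableD; [exact: aF|exact: aG].
by move=> z w zw; rewrite -[LHS]/(F w + G w) (sF z w zw) (sG z w zw) -conjMD.
Qed.

Lemma OsMZ U (a : R) (F : U -> quat R[i]) : OsM U F -> OsM U (a%:C *: F).
Proof.
move=> [aF sF]; split.
  by move=> z Uz; rewrite valL_scale; apply: derivableZ; exact: aF.
move=> z w zw; rewrite -[LHS]/(a%:C *: F w) (sF z w zw).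
by rewrite -[in LHS](conjc_real a) -conjMZ.
Qed.

Lemma OsMM U (F f : U -> quat R[i]) : OsM U F -> Os U f -> OsM U (F * f).
Proof.
move=> [aF sF] [[af sf] fC]; split.
  move=> z Uz; rewrite valL_scalarM//.
  under [X in derivable X]funext do rewrite mulr_algr.
  apply: derivableZ_fun; last exact: aF.
  exact/derivable_q0/af.
by move=> z w zw; rewrite -[LHS]/(F w * f w) (sF z w zw) (sf z w zw) -conjMM.
Qed.

Lemma OsD U (f g : U -> quat R[i]) : Os U f -> Os U g -> Os U (f + g).
Proof.
move=> [f1 fC] [g1 gC]; split; first exact: OsMD.
move=> z; have [c fz] := fC z; have [d gz] := gC z.
by exists (c + d); rewrite scalerDl -fz -gz.
Qed.

Lemma OsZ U (a : R) (f : U -> quat R[i]) : Os U f -> Os U (a%:C *: f).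
Proof.
move=> [f1 fC]; split; first exact: OsMZ.
by move=> z; have [c fz] := fC z; exists (a%:C * c); rewrite -scalerA -fz.
Qed.

Lemma Os_mul U (f g : U -> quat R[i]) : Os U f -> Os U g -> Os U (f * g).
Proof.
move=> fO gO; split; first by apply: OsMM => //; exact: fO.1.
move=> z; have [c fz] := fO.2 z; have [d gz] := gO.2 z.
by exists (c * d); rewrite -[LHS]/(f z * g z) fz gz mulr_algl scalerA.
Qed.

Lemma Os_mulC U (f g : U -> quat R[i]) : Os U f -> Os U g -> f * g = g * f.
Proof.
move=> [_ fC] [_ gC]; apply/funext => z; have [c fz] := fC z; have [d gz] := gC z.
by rewrite -[LHS]/(f z * g z) -[RHS]/(g z * f z) fz gz mulr_algl mulr_algr.
Qed.

(** The extension by 0 of the unit is the indicator function of U; it is locally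
    constant at the points of U because U is open. *)
Lemma Os1 U : open (U : set R[i]^o) -> Os U 1.
Proof.
move=> oU; split; last by move=> z; exists 1; rewrite scale1r.
split; last by move=> z w _; rewrite -[LHS]/1 -[X in conjM X]/1 -toM1 conjM_toM.
move=> z Uz; apply: (near_eq_derivable _ (derivable_cst (1 : quat R[i]) z 1)).
near=> w; have Uw : w \in U by apply/mem_set; near: w; exact: open_nbhs_nbhs.
by rewrite valL_in.
Unshelve. all: by end_near. Qed.

Lemma OsM0 U : OsM U 0.
Proof.
split; last by move=> z w _; rewrite -[LHS]/0 -[X in conjM X]/0 -toM0 conjM_toM.
move=> z Uz; suff -> : 'valL_0 (0 : U -> quat R[i]) = cst 0 by exact: derivable_cst.
apply/funext => w; have [Uw|Uw] := boolP (w \in U); [by rewrite valL_in|].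
by rewrite valL_out.
Qed.

(** * The transform on functions *)

Section FH.
Variable Omega : set (quat R).
Let U := spectral_image Omega.
Implicit Types (F G f : U -> quat R[i]) (q : Omega).

Lemma s_plus_spectral_image q : s_plus (\val q) \in U.
Proof. by apply/mem_set; exists (\val q); [exact: set_mem (valP q)|left]. Qed.

Lemma s_minus_spectral_image q : s_minus (\val q) \in U.
Proof. by apply/mem_set; exists (\val q); [exact: set_mem (valP q)|right]. Qed.

Lemma FHD F G : FH (F + G) = FH F + FH G.
Proof. by apply/funext => q; rewrite /FH valL_add qtransformD. Qed.

Lemma FHZ c F : FH (c *: F) = c *: FH F.
Proof. by apply/funext => q; rewrite /FH valL_scale qtransformZ. Qed.

Lemma FHM F f : Os U f -> FH (F * f) = FH F * FH f.
Proof.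
move=> [_ fC]; apply/funext => q; rewrite /FH valL_scalarM// qtransformM.
by rewrite -[RHS]/(qtransform _ _ * qtransform _ _) [in RHS](valL_Cscalar fC).
Qed.

Lemma FH1 : FH (1 : U -> quat R[i]) = 1.
Proof.
apply/funext => q; rewrite -[RHS](qtransform1 (\val q)) /FH !qtransformE.
rewrite (valL_in _ _ (s_plus_spectral_image q)).
by rewrite (valL_in _ _ (s_minus_spectral_image q)).
Qed.

Lemma FH_toM F q : OsM U F -> exists h, FH F q = toM h.
Proof.
move=> [_ sF]; apply: qtransform_stem.
rewrite (valL_in _ _ (s_plus_spectral_image q)).
by rewrite (valL_in _ _ (s_minus_spectral_image q)); exact: sF.
Qed.

(** By saturation the conjugate of a point q of Omega is in Omega too, and the
    values of F_H at both points determine F on the spectrum of q. *)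
Lemma FH_inj : spectrally_saturated Omega -> injective (@FH R Omega).
Proof.
move=> sat F G FG.
have eqT (q : quat R) : Omega q ->
    qtransform ('valL_0 F) q = qtransform ('valL_0 G) q.
  by move=> /mem_set Oq; exact: (congr1 (fun k => k (exist _ q Oq)) FG).
apply/funext => -[z Uz]; rewrite -!(valL_in _ 0).
have [q Oq] := set_mem Uz.
have Oq' : Omega (quat_conj q) by apply: sat Oq _; exact: spectrum_quat_conj.
case=> ->.
  by rewrite !(qtransform_inv_plus ('valL_0 _)) !eqT.
by rewrite !(qtransform_inv_minus ('valL_0 _)) !eqT.
Qed.

End FH.

Lemma set_bij_image (S T : Type) (A : set S) (f : S -> T) :
  injective f -> set_bij A (f @` A) f.
Proof.
by move=> inj; split=> [x Ax|x y _ _ /inj//|y//]; exists x.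
Qed.

End StemFunctions.

Theorem theorem5 (R : realType) :
  (forall Omega : set (quat R),
    spectrally_saturated Omega -> open Omega ->
    let U := spectral_image Omega in
    [/\ (forall (g : Omega -> quat R[i]) q, ROmegaH Omega g -> exists h : quat R, g q = toM h),
        unital_comm_real_algebra (ROmega Omega),
        right_module (ROmega Omega) (ROmegaH Omega),
        [/\ set_bij (OsM U) (ROmegaH Omega) (@FH R Omega),
            real_linear_on (OsM U) (@FH R Omega)
          & forall F f : U -> quat R[i], OsM U F -> Os U f ->
              FH (F * f) = FH F * FH f]
      & [/\ set_bij (Os U) (ROmega Omega) (@FH R Omega),
            real_linear_on (Os U) (@FH R Omega),
            FH (1 : U -> quat R[i]) = 1
          & forall f g : U -> quat R[i], Os U f -> Os U g ->
              FH (f * g) = FH f * FH g]]) /\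
  (forall (m : nat) (a : nat -> quat R) (q : quat R),
    qtransform (fun z : R[i] => \sum_(n < m.+1) toM (a n) * (z ^+ n)%:A) q
    = toM (\sum_(n < m.+1) a n * q ^+ n)).
Proof.
split; last by move=> m a q; exact: qtransform_poly.
move=> Omega sat oO U; have inj := FH_inj sat.
have oU : open (U : set R[i]^o) := open_spectral_image sat oO.
split.
- by move=> _ q [F OF <-]; exact: FH_toM.
- split.
  + by exists 1; [exact: Os1|exact: FH1].
  + by move=> _ _ [f Of <-] [g Og <-]; exists (f + g); [exact: OsD|exact: FHD].
  + by move=> a _ [f Of <-]; exists (a%:C *: f); [exact: OsZ|exact: FHZ].
  + by move=> _ _ [f Of <-] [g Og <-]; exists (f * g); [exact: Os_mul|exact: FHM].
  + by move=> _ _ [f Of <-] [g Og <-];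
       rewrite -(FHM f Og) -(FHM g Of) (Os_mulC Of Og).
- split.
  + exists 0; first exact: OsM0.
    by rewrite -(scale0r (0 : U -> quat R[i])) FHZ scale0r.
  + by move=> _ _ [F OF <-] [G OG <-]; exists (F + G); [exact: OsMD|exact: FHD].
  + move=> _ [F OF <-]; exists ((-1)%:C *: F); first exact: OsMZ.
    by rewrite FHZ rmorphN1 scaleN1r.
  + by move=> _ _ [F OF <-] [f Of <-]; exists (F * f); [exact: OsMM|exact: FHM].
- split; first exact: set_bij_image.
    by split=> [F G _ _|a F _]; [exact: FHD|exact: FHZ].
  by move=> F f _ Of; exact: FHM.
- split; first exact: set_bij_image.
  + by split=> [F G _ _|a F _]; [exact: FHD|exact: FHZ].
  + exact: FH1.
  + by move=> f g _ Og; exact: FHM.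
Qed.
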